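(* Let $(a,b)=(z^2,z)\in(\mathbb{F}_2[z]\setminus\mathbb{F}_2)^2$. Let $\mathbf{p}$ be the $(a,b)$-period-doubling sequence. The power series $\mathrm{CF}(\mathbf{p}(z))\in\mathbb{F}_2((1/z))$ is algebraic over $\mathbb{F}_2(z)$; its minimal polynomial (in the unknown $y$) is $$y^4+z^3y^2+(z^5+z^4)\,y+z^3+z^2+1.$$
   Context: For two distinct elements $a,b$ of an alphabet, the $(a,b)$-period-doubling sequence is the fixed point $\sigma^\infty(a)$ (starting with $a$) of the substitution $\sigma: a\mapsto ab,\ b\mapsto aa$. For a field $K$ and a sequence $\mathbf{a}(z)=(a_j(z))_{j\ge0}$ of polynomials in $K[z]\setminus K$, the continued fraction $$\mathrm{CF}(\mathbf{a}(z))=\cfrac{1}{a_0(z)+\cfrac{1}{a_1(z)+\cfrac{1}{a_2(z)+\cdots}}}$$ is the limit in $K((1/z))$ (which exists) of the finite continued fractions $$\mathrm{CF}_n(\mathbf{a}(z))=\cfrac{1}{a_0(z)+\cfrac{1}{a_1(z)+\cfrac{1}{\ddots+\cfrac{1}{a_n(z)}}}}\,.$$ Rational fractions are expanded in powers of $1/z$. *)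

(* Defs.v *)
From HB Require Import structures.
From mathcomp Require Import all_boot all_order all_algebra.
From mathcomp Require Import all_classical.
From mathcomp Require Import topology.
From mathcomp Require Import zify ring.

Set Implicit Arguments.
Unset Strict Implicit.
Unset Printing Implicit Defensive.

Import Order.TTheory GRing.Theory Num.Theory.

Local Open Scope classical_set_scope.
Local Open Scope ring_scope.
Local Open Scope quotient_scope.

Notation "x %:F" := (FracField.tofrac x) : ring_scope.

(* [laurent K] is the field K((1/z)). The coefficients are indexed by the power
   of z (not of 1/z), hence the support is bounded above. *)
Record laurent (K : fieldType) := Laurent {
  coefl :> int -> K;
  coefl_bounded : exists N : int, forall n, N < n -> coefl n = 0 }.

HB.instance Definition _ (K : fieldType) := gen_eqMixin (laurent K).
HB.instance Definition _ (K : fieldType) := gen_choiceMixin (laurent K).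

Section LaurentRing.
Variable K : fieldType.
Implicit Types (f g h : laurent K) (n N M : int).

Lemma laurentP f g : (forall n, f n = g n) <-> f = g.
Proof.
split=> [|-> //]; case: f g => [f f0] [g g0] /= /funext fg.
by move: f0 g0; rewrite fg => f0 g0; congr Laurent; exact: Prop_irrelevance.
Qed.

Definition deg_le f N := forall n, N < n -> f n = 0.

Lemma deg_leW f N M : N <= M -> deg_le f N -> deg_le f M.
Proof. by move=> NM fN n Mn; apply/fN/(le_lt_trans NM). Qed.

Lemma zero_bounded : exists N : int, forall n, N < n -> (0 : K) = 0.
Proof. by exists 0. Qed.
Definition zerol := @Laurent K (fun=> 0) zero_bounded.

Lemma opp_bounded f : exists N : int, forall n, N < n -> - f n = 0.
Proof.
by have [N fN] := coefl_bounded f; exists N => n /fN ->; rewrite oppr0.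
Qed.
Definition oppl f := Laurent (opp_bounded f).

Lemma add_bounded f g : exists N : int, forall n, N < n -> f n + g n = 0.
Proof.
have [N fN] := coefl_bounded f; have [M gM] := coefl_bounded g.
exists (Num.max N M) => n; rewrite gt_max => /andP[Nn Mn].
by rewrite fN // gM // addr0.
Qed.
Definition addl f g := Laurent (add_bounded f g).

Lemma addlA : associative addl.
Proof. by move=> f g h; apply/laurentP => n /=; rewrite addrA. Qed.
Lemma addlC : commutative addl.
Proof. by move=> f g; apply/laurentP => n /=; rewrite addrC. Qed.
Lemma add0l : left_id zerol addl.
Proof. by move=> f; apply/laurentP => n /=; rewrite add0r. Qed.
Lemma addNl : left_inverse zerol oppl addl.
Proof. by move=> f; apply/laurentP => n /=; rewrite addNr. Qed.

HB.instance Definition _ :=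
  GRing.isZmodule.Build (laurent K) addlA addlC add0l addNl.

Lemma coefl0 n : (0 : laurent K) n = 0. Proof. by []. Qed.
Lemma coeflD f g n : (f + g) n = f n + g n. Proof. by []. Qed.
Lemma coeflN f n : (- f) n = - f n. Proof. by []. Qed.
Lemma coeflB f g n : (f - g) n = f n - g n. Proof. by []. Qed.

Lemma deg_leD f g N : deg_le f N -> deg_le g N -> deg_le (f + g) N.
Proof. by move=> fN gN n Nn; rewrite coeflD fN // gN // addr0. Qed.

Lemma deg_leN f N : deg_le f N -> deg_le (- f) N.
Proof. by move=> fN n Nn; rewrite coeflN fN // oppr0. Qed.

(* The sum has finite support; see [convE] below. *)
Definition conv f g n : K := \sum_(i \in [set: int]) f i * g (n - i).

Lemma conv_seq f g n (s : seq int) : uniq s ->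
  (forall i, i \notin s -> f i * g (n - i) = 0) ->
  conv f g n = \sum_(i <- s) f i * g (n - i).
Proof.
move=> us s0; rewrite /conv -(fsbig_fwiden s [set` s]) //; last first.
  by move=> i [].
by apply/esym/fsbig_widen => // i [_ /= /negP /s0].
Qed.

Lemma convE f g N M (j : nat) : deg_le f N -> deg_le g M ->
  conv f g (N + M - j%:Z) =
    \sum_(k < j.+1) f (N - k%:Z) * g (M - (j - k)%N%:Z).
Proof.
move=> fN gM; rewrite (conv_seq (s := [seq N - k%:Z | k <- iota 0 j.+1])).
- rewrite big_map -/(index_iota 0 j.+1) big_mkord; apply: eq_bigr => k _.
  by congr (_ * g _); have := ltn_ord k; lia.
- by rewrite map_inj_uniq ?iota_uniq // => a b; lia.
move=> i /mapP iN; have [/fN ->|iN'] := ltP N i; first by rewrite mul0r.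
rewrite [X in _ * X]gM ?mulr0 //; apply/negP => iM; apply: iN.
by exists `|N - i|%N; rewrite ?mem_iota; lia.
Qed.

Lemma conv_deg f g N M : deg_le f N -> deg_le g M ->
  forall n, N + M < n -> conv f g n = 0.
Proof.
move=> fN gM n NMn; rewrite (conv_seq (s := [::])) ?big_nil // => i _.
have [/fN ->|iN] := ltP N i; first by rewrite mul0r.
by rewrite [X in _ * X]gM ?mulr0 //; lia.
Qed.

Lemma mul_bounded f g : exists N : int, forall n, N < n -> conv f g n = 0.
Proof.
have [N fN] := coefl_bounded f; have [M gM] := coefl_bounded g.
by exists (N + M); exact: conv_deg.
Qed.
Definition mull f g := Laurent (mul_bounded f g).

Lemma coef1_bounded : exists N : int, forall n, N < n -> ((n == 0)%:R : K) = 0.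
Proof. by exists 0 => n; rewrite lt_def => /andP[/negPf ->]. Qed.
Definition onel := Laurent coef1_bounded.

Lemma deg_mull f g N M : deg_le f N -> deg_le g M -> deg_le (mull f g) (N + M).
Proof. exact: conv_deg. Qed.

Let tr f N m : {poly K} := \poly_(k < m) f (N - k%:Z).

Lemma mull_tr f g N M (j m : nat) : deg_le f N -> deg_le g M -> (j < m)%N ->
  mull f g (N + M - j%:Z) = (tr f N m * tr g M m)`_j.
Proof.
move=> fN gM jm; rewrite [LHS]convE // coefM; apply: eq_bigr => k _.
have km : (k < m)%N by apply: leq_ltn_trans jm; rewrite -ltnS.
by rewrite !coef_poly km (leq_ltn_trans (leq_subr _ _) jm).
Qed.

Lemma eq_laurent f g N : deg_le f N -> deg_le g N ->
  (forall j : nat, f (N - j%:Z) = g (N - j%:Z)) -> f = g.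
Proof.
move=> fN gN fg; apply/laurentP => n; have [Nn|nN] := ltP N n.
  by rewrite fN // gN.
by have -> : n = N - `|N - n|%N%:Z by lia.
Qed.

Lemma mullC : commutative mull.
Proof.
move=> f g.
have [N fN] := coefl_bounded f; have [M gM] := coefl_bounded g.
apply: (@eq_laurent _ _ (N + M)); [exact: deg_mull| |move=> j].
  by rewrite addrC; exact: deg_mull.
rewrite (mull_tr (m := j.+1)) // (addrC N) (mull_tr (m := j.+1)) //.
by rewrite mulrC.
Qed.

Lemma mullA : associative mull.
Proof.
move=> f g h.
have [N fN] := coefl_bounded f; have [M gM] := coefl_bounded g.
have [P hP] := coefl_bounded h.
have fgNM := deg_mull fN gM; have ghMP := deg_mull gM hP.
apply: (@eq_laurent _ _ (N + M + P)); last move=> j.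
- by rewrite -addrA; apply: deg_mull.
- exact: deg_mull.
rewrite [RHS](mull_tr (m := j.+1)) // -(addrA N M P).
rewrite [LHS](mull_tr (m := j.+1)) //.
have -> : (tr f N j.+1 * tr (mull g h) (M + P) j.+1)`_j =
          (tr f N j.+1 * (tr g M j.+1 * tr h P j.+1))`_j.
  rewrite !coefM; apply: eq_bigr => k _; congr (_ * _).
  by rewrite coef_poly ltnS leq_subr (mull_tr (m := j.+1)) // ltnS leq_subr.
rewrite mulrA coefM [RHS]coefM; apply: eq_bigr => k _; congr (_ * _).
by rewrite coef_poly ltn_ord (mull_tr (m := j.+1)).
Qed.

Lemma mul1l : left_id onel mull.
Proof.
move=> f; apply/laurentP => n /=; rewrite (conv_seq (s := [:: 0])) //.
  by rewrite big_seq1 subr0 /= mul1r.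
by move=> i; rewrite inE => /negPf /= ->; rewrite mul0r.
Qed.

Lemma mullDl : left_distributive mull addl.
Proof.
move=> f g h.
have [N fN] := coefl_bounded f; have [N' gN] := coefl_bounded g.
pose M := Num.max N N'.
have fM : deg_le f M by apply: deg_leW fN; rewrite le_max lexx.
have gM : deg_le g M by apply: deg_leW gN; rewrite le_max lexx orbT.
have [P hP] := coefl_bounded h; have fgM := deg_leD fM gM.
apply: (@eq_laurent _ _ (M + P)); last move=> j.
- exact: deg_mull.
- by apply: deg_leD; apply: deg_mull.
rewrite [LHS]convE // [RHS]coeflD ![mull _ _ _]convE // -big_split /=.
by apply: eq_bigr => k _; rewrite mulrDl.
Qed.

Lemma onel_neq0 : onel != 0.
Proof.
by apply/eqP => /laurentP/(_ 0) /= /eqP; rewrite oner_eq0.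
Qed.

HB.instance Definition _ := GRing.Zmodule_isComNzRing.Build (laurent K)
  mullA mullC mul1l mullDl onel_neq0.

Lemma coefl1 n : (1 : laurent K) n = (n == 0)%:R. Proof. by []. Qed.
Lemma coeflM f g n : (f * g) n = \sum_(i \in [set: int]) f i * g (n - i).
Proof. by []. Qed.

Lemma deg_leM f g N M : deg_le f N -> deg_le g M -> deg_le (f * g) (N + M).
Proof. exact: deg_mull. Qed.

Lemma deg_leM_lead f g N M : deg_le f N -> deg_le g M ->
  (f * g) (N + M) = f N * g M.
Proof.
move=> fN gM; have := convE 0 fN gM; rewrite big_ord1 !subr0 => <-.
by [].
Qed.

Lemma lead_exists f : f != 0 -> exists2 N, deg_le f N & f N != 0.
Proof.
move=> f0; have [N fN] := coefl_bounded f.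
have ex : exists k : nat, f (N - k%:Z) != 0.
  apply: contrapT => /forallNP fk0; move/eqP: f0; apply.
  apply: (@eq_laurent _ _ N) => // j.
  by rewrite coefl0; apply/eqP/negPn/negP/fk0.
case: (ex_minnP ex) => m fm minm; exists (N - m%:Z) => // n mn.
have [/fN //|nN] := ltP N n; apply/eqP/negPn/negP => fn0.
have nE : N - `|N - n|%N%:Z = n by lia.
by have : (m <= `|N - n|)%N by [apply: minm; rewrite nE]; lia.
Qed.

(* If c lists the coefficients of a power series with constant term c 0 != 0,
   then [inv_seq c n] lists the first n coefficients of its inverse. *)
Fixpoint inv_seq (c : nat -> K) (n : nat) : seq K :=
  if n isn't m.+1 then [::] else
  let s := inv_seq c m in
  rcons s (((m == 0%N)%:R - \sum_(i < m) c (m - i)%N * s`_i) / c 0%N).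

Lemma size_inv_seq c (n : nat) : size (inv_seq c n) = n.
Proof. by elim: n => //= n IHn; rewrite size_rcons IHn. Qed.

Lemma nth_inv_seq c (n k : nat) : (k < n)%N ->
  (inv_seq c n)`_k = (inv_seq c k.+1)`_k.
Proof.
elim: n => // n IHn; rewrite ltnS leq_eqVlt => /predU1P[-> //|kn] /=.
by rewrite nth_rcons size_inv_seq kn IHn.
Qed.

Lemma inv_seqP c (m : nat) : c 0%N != 0 ->
  \sum_(i < m.+1) c (m - i)%N * (inv_seq c i.+1)`_i = (m == 0%N)%:R.
Proof.
move=> c0; rewrite big_ord_recr /= nth_rcons size_inv_seq ltnn eqxx subnn.
rewrite mulrC divfK //.
under eq_bigr => i _.
  rewrite -[rcons _ _]/(inv_seq c i.+1) -(nth_inv_seq _ (ltn_ord i)); over.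
by rewrite addrC subrK.
Qed.

Lemma laurent_inv_ex f : f != 0 -> exists g, g * f = 1.
Proof.
move=> /lead_exists[N fN fN0]; pose c (k : nat) := f (N - k%:Z).
pose d n := if n <= - N then (inv_seq c (absz (- N - n)%R).+1)`_(absz (- N - n)%R) else 0.
have d_bounded : exists M : int, forall n, M < n -> d n = 0.
  by exists (- N) => n; rewrite /d ltNge => /negPf ->.
pose g := Laurent d_bounded.
have gN : deg_le g (- N) by move=> n; rewrite /= /d ltNge => /negPf ->.
have fgN : deg_le (g * f) 0 by rewrite -(addNr N); exact: deg_leM.
exists g; apply: (eq_laurent fgN) => [n|j].
  by rewrite lt_def coefl1 => /andP[/negPf ->].
rewrite -{1}(addNr N) [LHS]convE // coefl1.
transitivity (\sum_(i < j.+1) c (j - i)%N * (inv_seq c i.+1)`_i).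
  apply: eq_bigr => i _; rewrite mulrC; congr (_ * _).
  rewrite /= /d ifT; last by lia.
  by have -> : absz (- N - (- N - i%:Z))%R = i by lia.
rewrite inv_seqP; last by rewrite /c subr0.
by congr (_%:R); lia.
Qed.

Definition invl f : laurent K := xget 0 [set g | g * f = 1].

Lemma mulVl f : f != 0 -> invl f * f = 1.
Proof.
move=> /laurent_inv_ex f0.
by have /= := @xgetPex _ 0 [set g | g * f = 1] f0.
Qed.

Lemma invl0 : invl 0 = 0.
Proof.
rewrite /invl; case: xgetP => // g _ /= /esym/eqP.
by rewrite mulr0 oner_eq0.
Qed.

HB.instance Definition _ := GRing.ComNzRing_isField.Build (laurent K) mulVl invl0.

Lemma deg_leV f N : deg_le f N -> f N != 0 -> deg_le f^-1 (- N).
Proof.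
move=> fN fN0; have f0 : f != 0.
  by apply: contra_neq fN0 => ->; rewrite coefl0.
have /lead_exists[M gM gM0] : f^-1 != 0 by rewrite invr_eq0.
have : (f * f^-1) (N + M) != 0 by rewrite deg_leM_lead // mulf_neq0.
rewrite divff // coefl1; case: (N + M =P 0) => [NM _|_ /eqP//].
by have -> : - N = M by lia.
Qed.

End LaurentRing.

Section LaurentTopology.
Variable K : fieldType.
Local Notation L := (laurent K).

(* The (1/z)-adic uniform structure: two series are close when their
   coefficients agree in all degrees >= m, with m close to -oo. *)
Definition laurent_ball (m : int) : set (L * L) :=
  [set fg : L * L | forall n : int, m <= n -> fg.1 n = fg.2 n].

Definition laurent_entourage : set_system (L * L) :=
  filter_from [set: int] laurent_ball.

Lemma laurent_entourage_filter : Filter laurent_entourage.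
Proof.
apply: filter_from_filter; first by exists 0.
move=> m p _ _; exists (Num.min m p) => // -[f g] fg.
by split=> n mn; apply: fg; rewrite ge_min mn ?orbT.
Qed.

Lemma laurent_entourage_diagonal A :
  laurent_entourage A -> (diagonal `<=` A)%relation.
Proof. by move=> [m _ mA] [f g] /diagonalP ->; apply: mA. Qed.

Lemma laurent_entourage_inv A :
  laurent_entourage A -> laurent_entourage (A^-1)%relation.
Proof.
by move=> [m _ mA]; exists m => // -[f g] fg; apply: mA => n /fg.
Qed.

Lemma laurent_entourage_split A : laurent_entourage A ->
  exists2 B, laurent_entourage B & (B \; B `<=` A)%relation.
Proof.
move=> [m _ mA]; exists (laurent_ball m); first by exists m.
by move=> [f h] [g /= fg gh]; apply: mA => n mn /=; rewrite (fg n mn) gh.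
Qed.

HB.instance Definition _ := isPointed.Build L 0.
HB.instance Definition _ := isUniform.Build L laurent_entourage_filter
  laurent_entourage_diagonal laurent_entourage_inv laurent_entourage_split.

Lemma laurent_cvgP (u : nat -> L) (f : L) : u @ \oo --> f <->
  forall m : int, \forall k \near \oo, forall n, m <= n -> f n = u k n.
Proof.
split=> [/cvg_app_entourageP uf m|uf].
  by apply: (uf (laurent_ball m)); exists m.
apply/cvg_app_entourageP => A [m _ mA].
by apply: filterS (uf m) => k fu; apply: mA.
Qed.

Lemma laurent_hausdorff : hausdorff_space L.
Proof.
move=> f g fg; apply/laurentP => n.
have nE : entourage (laurent_ball n) by exists n.
have [h []] := fg _ _ (nbhs_entourage f nE) (nbhs_entourage g nE).
by move=> /xsectionP fh /xsectionP gh; rewrite (fh n) // (gh n).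
Qed.

End LaurentTopology.

Section Embeddings.
Variable K : fieldType.
Implicit Types (p q : {poly K}) (x : {fraction {poly K}}).

Lemma polyl_bounded p : exists N : int, forall n : int, N < n ->
  (if n is Posz k then p`_k else 0) = 0.
Proof.
exists (size p)%:Z => -[k|//] pk.
by rewrite nth_default // -lez_nat ltW.
Qed.

Definition polyl p : laurent K := Laurent (polyl_bounded p).

Lemma polyl_is_zmod_morphism : zmod_morphism polyl.
Proof.
move=> p q; apply/laurentP => -[k|k] /=; first by rewrite coefB.
by rewrite subr0.
Qed.

Lemma polyl_is_monoid_morphism : monoid_morphism polyl.
Proof.
split=> [|p q]; apply/laurentP => n.
  by rewrite coefl1; case: n => [k|k] //=; rewrite coef1.
case: n => [n|n]; last first.
  rewrite [RHS](conv_seq (s := [::])) ?big_nil // => -[k|k] _.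
    have e : Negz n - k%:Z = Negz (n + k)%N by lia.
    by rewrite e /= mulr0.
  by rewrite /= mul0r.
rewrite [RHS](conv_seq (s := [seq k%:Z | k <- iota 0 n.+1])).
- rewrite big_map -/(index_iota 0 n.+1) big_mkord /= coefM.
  apply: eq_bigr => k _.
  by have -> : n%:Z - k%:Z = (n - k)%N%:Z by have := ltn_ord k; lia.
- by rewrite map_inj_uniq ?iota_uniq // => a b [].
move=> [k|k]; last by rewrite /= mul0r.
rewrite mem_map ?mem_iota => [|a b []//]; rewrite add0n ltnS leq0n /= => nk.
have -> : n%:Z - k%:Z = Negz (k - n).-1 by lia.
by rewrite /= mulr0.
Qed.

HB.instance Definition _ :=
  GRing.isZmodMorphism.Build {poly K} (laurent K) polyl polyl_is_zmod_morphism.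
HB.instance Definition _ :=
  GRing.isMonoidMorphism.Build {poly K} (laurent K) polyl
    polyl_is_monoid_morphism.

Lemma polyl_eq0 p : (polyl p == 0) = (p == 0).
Proof.
apply/eqP/eqP => [p0|->]; last exact: rmorph0.
by apply/polyP => k; move/laurentP/(_ k%:Z): p0 => /= ->; rewrite coef0.
Qed.

(* Expansion of a rational fraction in powers of 1/z. *)
Definition ratl x : laurent K :=
  polyl \n_(repr x) / polyl \d_(repr x).

Lemma fracE x : x * (\d_(repr x))%:F = (\n_(repr x))%:F.
Proof.
rewrite -{1}[x]reprK; case: (repr x) => -[n d] /= d0; unlock FracField.tofrac.
rewrite -[LHS]FracField.pi_mul; apply/eqmodP; rewrite /= FracField.equivfE.
by rewrite /FracField.mulf !numden_Ratio ?mulr1 ?oner_eq0 // mulrC.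
Qed.

Lemma ratlE x p q : q != 0 -> x * q%:F = p%:F -> ratl x = polyl p / polyl q.
Proof.
move=> q0 xqp; rewrite /ratl; have d0 := denom_ratioP (repr x).
apply/eqP; rewrite eqr_div ?polyl_eq0 // -!rmorphM.
suff -> : \n_(repr x) * q = p * \d_(repr x) by [].
by apply/eqP; rewrite -tofrac_eq !rmorphM /= -fracE -xqp mulrAC.
Qed.

Lemma frac_ex x : exists p q, [/\ q != 0, x * q%:F = p%:F
  & ratl x = polyl p / polyl q].
Proof.
exists \n_(repr x), \d_(repr x); have d0 := denom_ratioP (repr x).
by split; rewrite ?fracE.
Qed.

Lemma ratl_is_zmod_morphism : zmod_morphism ratl.
Proof.
move=> x y; have [p [q [q0 xE ->]]] := frac_ex x.
have [r [s [s0 yE ->]]] := frac_ex y.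
rewrite (@ratlE _ (p * s - r * q) (q * s)) ?mulf_neq0 //; last first.
  by rewrite rmorphB !rmorphM /= -xE -yE; ring.
rewrite -[in RHS]mulNr addf_div ?polyl_eq0 // mulNr.
by rewrite (rmorphM _ q) (rmorphB _ (p * s)) (rmorphM _ p) (rmorphM _ r).
Qed.

Lemma ratl_is_monoid_morphism : monoid_morphism ratl.
Proof.
split=> [|x y].
  by rewrite (@ratlE _ 1 1) ?oner_eq0 ?mulr1 // divff // rmorph1 oner_eq0.
have [p [q [q0 xE ->]]] := frac_ex x.
have [r [s [s0 yE ->]]] := frac_ex y.
rewrite (@ratlE _ (p * r) (q * s)) ?mulf_neq0 //.
  by rewrite !rmorphM /= invfM mulrACA.
by rewrite !rmorphM /= -xE -yE mulrACA.
Qed.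

HB.instance Definition _ := GRing.isZmodMorphism.Build
  {fraction {poly K}} (laurent K) ratl ratl_is_zmod_morphism.
HB.instance Definition _ := GRing.isMonoidMorphism.Build
  {fraction {poly K}} (laurent K) ratl ratl_is_monoid_morphism.

Lemma ratl_tofrac p : ratl p%:F = polyl p.
Proof.
by rewrite (@ratlE _ p 1) ?oner_eq0 ?rmorph1 ?mulr1 // divr1.
Qed.

End Embeddings.

Section ContinuedFraction.
Variable K : fieldType.
Implicit Types (a : nat -> {poly K}) (p : {poly K}) (f g : laurent K).

Definition CFn a (n : nat) : {fraction {poly K}} :=
  foldr (fun p x => (p%:F + x)^-1) 0 (mkseq a n.+1).

Definition CF a : laurent K := lim ((fun n => ratl (CFn a n)) @ \oo).

Let step p f : laurent K := (polyl p + f)^-1.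

Lemma ratl_CFn a n : ratl (CFn a n) = foldr step 0 (mkseq a n.+1).
Proof.
rewrite /CFn; elim: (mkseq _ _) => [|p s IHs] /=; first exact: rmorph0.
by rewrite fmorphV rmorphD /= ratl_tofrac IHs.
Qed.

Lemma deg_step_denom p f : (1 < size p)%N -> deg_le f (- 1) ->
  deg_le (polyl p + f) (size p).-1%:Z /\ (polyl p + f) (size p).-1%:Z != 0.
Proof.
move=> p1 f1; split.
  apply: deg_leD; last by apply: deg_leW f1; lia.
  by move=> [k|//] /= kp; rewrite nth_default //; lia.
rewrite coeflD f1 ?addr0 //= -/(lead_coef p) lead_coef_eq0 -size_poly_gt0.
by apply: leq_trans p1.
Qed.

Lemma deg_step p f : (1 < size p)%N -> deg_le f (- 1) -> deg_le (step p f) (- 1).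
Proof.
move=> p1 f1; have [d d0] := deg_step_denom p1 f1.
by apply: deg_leW (deg_leV d d0); lia.
Qed.

Lemma deg_stepB p f g (N : int) : (1 < size p)%N ->
  deg_le f (- 1) -> deg_le g (- 1) ->
  deg_le (f - g) N -> deg_le (step p f - step p g) (N - 2).
Proof.
move=> p1 f1 g1 fgN; have [d d0] := deg_step_denom p1 f1.
have [e e0] := deg_step_denom p1 g1.
have nz (h : laurent K) : h (size p).-1%:Z != 0 -> h != 0.
  by apply: contra_neq => ->.
have -> : step p f - step p g = step p f * step p g * - (f - g).
  by rewrite /step; field; rewrite (nz _ d0) (nz _ e0).
apply: (@deg_leW _ _ ((- (size p).-1%:Z) + (- (size p).-1%:Z) + N)); first lia.
by apply: deg_leM (deg_leN fgN); apply: deg_leM; exact: deg_leV.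
Qed.

Lemma deg_foldr_step (s : seq {poly K}) f :
  (forall p, p \in s -> (1 < size p)%N) ->
  deg_le f (- 1) -> deg_le (foldr step f s) (- 1).
Proof.
elim: s => //= p s IHs ps f1; apply: deg_step; first by rewrite ps ?mem_head.
by apply: IHs => // q qs; rewrite ps // inE qs orbT.
Qed.

Lemma deg_foldr_stepB (s : seq {poly K}) f g :
  (forall p, p \in s -> (1 < size p)%N) ->
  deg_le f (- 1) -> deg_le g (- 1) ->
  deg_le (foldr step f s - foldr step g s) (- 1 - (size s).*2%:Z).
Proof.
elim: s => [|p s IHs] /= ps f1 g1.
  by rewrite subr0; exact: deg_leD (deg_leN g1).
have ps' q : q \in s -> (1 < size q)%N by move=> qs; rewrite ps // inE qs orbT.
rewrite (_ : - 1 - _ = - 1 - (size s).*2%:Z - 2); last by lia.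
apply: deg_stepB; last exact: IHs.
- by rewrite ps ?mem_head.
- exact: deg_foldr_step.
- exact: deg_foldr_step.
Qed.

(* The limit defining [CF a] exists when no a_j is a constant. *)
Lemma CF_cvg a : (forall j, (1 < size (a j))%N) ->
  (fun n => ratl (CFn a n)) @ \oo --> CF a.
Proof.
move=> a1; set u := fun n => _.
have deg0 : deg_le (0 : laurent K) (- 1) by [].
have as1 (r : seq nat) p : p \in map a r -> (1 < size p)%N.
  by move=> /mapP[j _ ->].
have u1 n : deg_le (u n) (- 1).
  by rewrite /u ratl_CFn; apply: deg_foldr_step => // p /as1.
have uB n k : deg_le (u (n + k)%N - u n) (- n%:Z).
  rewrite /u !ratl_CFn -addSn /mkseq iotaD map_cat foldr_cat.
  apply: deg_leW (deg_foldr_stepB _ _ deg0) => [|p /as1 //|].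
    by rewrite size_map size_iota; lia.
  by apply: deg_foldr_step => // p /as1.
have uE n n' (k : int) : - n%:Z < k -> - n'%:Z < k -> u n k = u n' k.
  wlog nn' : n n' / (n <= n')%N => [H|nk _].
    by have [/H|/ltnW /H nn' ? ?] := leqP n n'; [exact|apply/esym/nn'].
  apply/esym/eqP; rewrite -subr_eq0 -coeflB -(subnKC nn').
  by rewrite uB.
have f_bounded : exists N : int, forall k, N < k -> u `|k|%N.+1 k = 0.
  by exists (- 1) => k /u1.
suff uf : u @ \oo --> Laurent f_bounded by apply: cvgP uf.
apply/laurent_cvgP => m; exists `|m|%N.+1 => // n /= mn k mk.
by apply: uE; lia.
Qed.

End ContinuedFraction.

Section PeriodDoubling.
Variable T : eqType.
Implicit Types (a b : T) (w : seq T).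

(* [pd_subst a b] is only meant for letters of the alphabet {a, b}, a != b. *)
Definition pd_subst a b (x : T) : seq T :=
  if x == a then [:: a; b] else [:: a; a].

Definition pd_subst_word a b w : seq T := flatten (map (pd_subst a b) w).

(* sigma^n(a) has length 2 ^ n > n and is a prefix of sigma^(n+1)(a), so that the
   n-th letter of sigma^oo(a) is that of sigma^n(a). *)
Definition period_doubling a b (n : nat) : T :=
  nth a (iter n (pd_subst_word a b) [:: a]) n.

Lemma size_pd_iter a b n : size (iter n (pd_subst_word a b) [:: a]) = (2 ^ n)%N.
Proof.
have sz w : size (pd_subst_word a b w) = (size w).*2.
  elim: w => //= x w IHw; rewrite /pd_subst_word /= size_cat IHw.
  by rewrite /pd_subst; case: ifP.
by elim: n => //= n IHn; rewrite sz IHn expnS mul2n.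
Qed.

Lemma nth_pd_subst_word a b w n : (n < size w)%N ->
  nth a (pd_subst_word a b w) n.*2 = a /\
  nth a (pd_subst_word a b w) n.*2.+1 = nth a (pd_subst a b (nth a w n)) 1.
Proof.
elim: w n => // x w IHw [_|n /IHw [IH0 IH1]].
  by rewrite /pd_subst_word /= /pd_subst; case: ifP.
rewrite /pd_subst_word /= doubleS.
by rewrite {1 3}/pd_subst; case: ifP.
Qed.

Lemma nth_pd_iter a b n k : (k < 2 ^ n)%N ->
  nth a (iter n (pd_subst_word a b) [:: a]) k = period_doubling a b k.
Proof.
have stab i m : (i < 2 ^ m)%N ->
    nth a (iter m.+1 (pd_subst_word a b) [:: a]) i =
    nth a (iter m (pd_subst_word a b) [:: a]) i.
  elim: m i => [|m IHm] i; first by case: i => // _; rewrite /pd_subst_word /= /pd_subst eqxx.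
  rewrite expnS => im; rewrite iterS [in RHS]iterS.
  have i2 : (i./2 < 2 ^ m)%N by rewrite ltn_half_double -mul2n.
  have i2' : (i./2 < 2 ^ m.+1)%N by rewrite expnS; lia.
  have [e0 e1] := @nth_pd_subst_word a b
    (iter m.+1 (pd_subst_word a b) [:: a]) i./2 ltac:(rewrite size_pd_iter //).
  have [f0 f1] := @nth_pd_subst_word a b
    (iter m (pd_subst_word a b) [:: a]) i./2 ltac:(rewrite size_pd_iter //).
  rewrite -(odd_double_half i); case: (odd i); rewrite ?add0n ?add1n.
    by rewrite e1 f1 IHm.
  by rewrite e0 f0.
have stabD i m d : (i < 2 ^ m)%N ->
    nth a (iter (d + m) (pd_subst_word a b) [:: a]) i =
    nth a (iter m (pd_subst_word a b) [:: a]) i.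
  move=> im; elim: d => // d <-; rewrite addSn stab //.
  by apply: leq_trans im _; rewrite leq_exp2l // leq_addl.
move=> kn; rewrite /period_doubling; have [nk|/ltnW kn'] := leqP n k.
  by rewrite -{2}(subnK nk) stabD.
by rewrite -{1}(subnK kn') stabD // ltn_expl.
Qed.

Lemma period_doubling0 a b : period_doubling a b 0 = a.
Proof. by []. Qed.

Lemma period_doubling_fixed a b n :
  [:: period_doubling a b n.*2; period_doubling a b n.*2.+1] =
  pd_subst a b (period_doubling a b n).
Proof.
have nn := ltn_expl n (ltnSn 1).
have sz : (n.*2.+1 < 2 ^ n.+1)%N by rewrite expnS; lia.
rewrite -(@nth_pd_iter a b n.+1) 1?ltnW // -(@nth_pd_iter a b n.+1) // iterS.
have [-> ->] := @nth_pd_subst_word a b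
  (iter n (pd_subst_word a b) [:: a]) n ltac:(rewrite size_pd_iter //).
by rewrite nth_pd_iter // /pd_subst; case: ifP.
Qed.

End PeriodDoubling.

(* The minimal polynomial of y : E over F, along the field embedding i. *)
Definition is_min_poly (F E : fieldType) (i : {rmorphism F -> E}) (y : E)
    (P : {poly F}) : Prop :=
  [/\ P \is monic, root (map_poly i P) y
    & forall Q : {poly F}, Q != 0 -> root (map_poly i Q) y ->
        (size P <= size Q)%N].

(* Main.v *)
Require Import Defs.
From mathcomp Require Import all_boot all_order all_algebra.
From mathcomp Require Import all_classical.
From mathcomp Require Import topology.
From mathcomp Require Import zify ring.

Set Implicit Arguments.
Unset Strict Implicit.
Unset Printing Implicit Defensive.

Import Order.TTheory GRing.Theory Num.Theory.

Local Open Scope ring_scope.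

(** Let X_n be the prefix of length 2^n - 1 of the period-doubling sequence p, and
    x_n the letter that follows it, which is a for even n and b for odd n. Then
    X_(n+1) is X_n x_n X_n, and all the X_n are palindromes. In characteristic
    2, the folding lemma [folding] says that the continued fraction of a word s x s',
    with s' the reversal of s, is that of s plus 1 / (x Q^2), where Q is the
    denominator for s, and that the denominator for s x s' is x Q^2. Hence CF(p) is the sum
    of the inverses of the denominators x_n Q_n^2 = Q_(n+1). For a = z^2 and b = z
    these are the powers of z with exponents 2, 5, 12, 25, 52, 105, and so on.

    Let u be the sum of every other term, with exponents 2, 12, 52, ...: an
    exponent e is followed by 4 e + 4, so that u = z^-2 + z^-4 u^4, since the fourth
    power is additive. The other exponents 5, 25, 105, ... are the 2 e + 1, so
    that CF(p) = u + u^2 / z. Eliminating u gives the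
    quartic equation ([quartic_root]).

    For minimality, the exponents of u grow so fast that its truncations
    contradict Liouville's inequality for any algebraic number of degree at
    most 3 ([lacunary_degree_gt]): 1, u, u^2 and u^3 are linearly independent
    over the rational fractions. The exponents of CF(p) itself only double, which
    is too slow for this argument; instead, the coordinates of 1, y, y^2 and y^3,
    for y = CF(p), on the powers of u form an invertible matrix, so that y has
    degree at least 4 as well. The whole argument works over any field of
    characteristic 2. *)

(** * Liouville's inequality in K((1/z)) *)

Section Liouville.
Variable K : fieldType.
Implicit Types (f g : laurent K) (p q : {poly K}).

Lemma deg_le_polyl p : deg_le (polyl p) (size p).-1%:Z.
Proof.
by move=> [k|//]; rewrite ltz_nat => pk /=; rewrite nth_default //; case: (size p) pk.
Qed.

Lemma deg_le_polylX f q N (n : nat) : deg_le f N ->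
  deg_le (f * polyl q ^+ n) (N + ((size q).-1 * n)%N%:Z).
Proof.
move=> fN; elim: n => [|n IHn]; first by rewrite mulr1 muln0 addr0.
rewrite exprSr mulrA mulnSr PoszD addrA.
exact: deg_leM (deg_le_polyl (p := q)).
Qed.

Lemma polyl_deg_neg p : deg_le (polyl p) (-1) -> p = 0.
Proof. by move=> p1; apply/polyP => k; rewrite coef0; apply: (p1 k%:Z). Qed.

(** Once the coefficients are polynomials, the denominator of a value at p / q is
    a power of q. *)
Lemma clear_denominators (Q : {poly {fraction {poly K}}}) :
  exists D (R : {poly {poly K}}),
    D != 0 /\ map_poly (@polyl K) R = polyl D *: map_poly (@ratl K) Q.
Proof.
elim/poly_ind: Q => [|Q c [D [R [D0 RE]]]].
  by exists 1, 0; rewrite oner_eq0 !rmorph0 scaler0.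
have [n [d [d0 _ cE]]] := frac_ex c.
exists (D * d), (d *: R * 'X + (D * n)%:P); rewrite mulf_neq0 //; split=> //.
have nE : polyl n = polyl d * ratl c by rewrite cE mulrC divfK ?polyl_eq0.
rewrite !(rmorphD, rmorphM) /= !map_polyX !map_polyC map_polyZ /= RE.
by rewrite scalerDr -!mul_polyC !rmorphM /= nE !rmorphM /=; ring.
Qed.

(** A polynomial function is Lipschitz on bounded sets for the absolute value
    given by the degree. *)
Lemma horner_lipschitz (r : {poly laurent K}) f N : deg_le f N ->
  exists C : int, forall g M, deg_le g N -> deg_le (g - f) M ->
    deg_le (r.[g] - r.[f]) (M + C).
Proof.
move=> fN; elim/poly_ind: r => [|r c [C IHr]].
  by exists 0 => g M _ _ n _; rewrite !horner0 subr0.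
have [B rB] := coefl_bounded r.[f].
exists (Num.max (C + N) B) => g M gN gfM.
have -> : (r * 'X + c%:P).[g] - (r * 'X + c%:P).[f] =
    (r.[g] - r.[f]) * g + (g - f) * r.[f] by rewrite !hornerE; ring.
apply: deg_leD.
  by apply: deg_leW (deg_leM (IHr g M gN gfM) gN); lia.
by apply: deg_leW (deg_leM gfM rB); lia.
Qed.

Lemma horner_fraction (R : {poly {poly K}}) p q d : q != 0 -> (size R <= d.+1)%N ->
  exists w, (map_poly (@polyl K) R).[polyl p / polyl q] * polyl q ^+ d = polyl w.
Proof.
move=> q0 Rd; have ql0 : polyl q != 0 by rewrite polyl_eq0.
exists (\sum_(i < d.+1) R`_i * p ^+ i * q ^+ (d - i)).
rewrite (horner_coef_wide (n := d.+1)); last exact: leq_trans (size_poly _ _) Rd.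
rewrite mulr_suml rmorph_sum; apply: eq_bigr => i _ /=.
rewrite coef_map /= !rmorphM !rmorphXn /= expr_div_n.
have -> : polyl q ^+ d = polyl q ^+ (d - i) * polyl q ^+ i.
  by rewrite -exprD subnK // -ltnS.
by field; rewrite expf_neq0.
Qed.

(** The numerator of R(p / q) is a polynomial, hence has degree at least 0 unless
    it vanishes, while R(p / q) = R(p / q) - R(f) has about the degree
    of p / q - f. The exponent d bounds the power of q in the denominator. *)
Theorem liouville (Q : {poly {fraction {poly K}}}) f d N :
  deg_le f N -> root (map_poly (@ratl K) Q) f -> (size Q <= d.+1)%N ->
  exists C : int, forall p q M, q != 0 ->
    deg_le (polyl p / polyl q) N -> deg_le (polyl p / polyl q - f) M ->
    M + ((size q).-1 * d)%N%:Z < C -> root (map_poly (@ratl K) Q) (polyl p / polyl q).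
Proof.
move=> fN Qf Qd; have [D [R [D0 RE]]] := clear_denominators Q.
have Dl0 : polyl D != 0 by rewrite polyl_eq0.
have Rsz : (size R <= d.+1)%N.
  apply: leq_trans Qd; rewrite -(size_map_poly (@ratl K) Q).
  by rewrite -(size_scale _ Dl0) -RE size_map_inj_poly ?rmorph0 // => x y /eqP;
     rewrite -subr_eq0 -rmorphB polyl_eq0 subr_eq0 => /eqP.
have [C RC] := horner_lipschitz (map_poly (@polyl K) R) fN.
exists (- C) => p q M q0 pqN pqM MC.
have [w wE] := horner_fraction p q0 Rsz.
have Rf0 : (map_poly (@polyl K) R).[f] = 0.
  by rewrite RE hornerZ (rootP Qf) mulr0.
have := RC _ _ pqN pqM; rewrite Rf0 subr0 => /(deg_le_polylX (q := q) (n := d)).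
rewrite wE => wdeg; have w0 : w = 0.
  by apply/polyl_deg_neg/(deg_leW _ wdeg); lia.
move: wE; rewrite w0.
move/eqP; rewrite rmorph0 mulf_eq0 expf_eq0 polyl_eq0 (negPf q0) andbF orbF.
by rewrite RE hornerZ mulf_eq0 (negPf Dl0).
Qed.

End Liouville.

(** * Lacunary series *)

Section Lacunary.
Variable K : fieldType.
Implicit Types (f g : laurent K) (e : nat -> nat).

Definition lac_sum e k : laurent K := \sum_(j < k) polyl 'X ^- e j.

(** For increasing [e], this says that [f] is the sum of all the [z ^- e j],
    with the speed of convergence built in. *)
Definition is_lacunary e f :=
  forall k, deg_le (f - lac_sum e k) (- (e k)%:Z).

Lemma lac_sumS e k : lac_sum e k.+1 = lac_sum e k + polyl 'X ^- e k.
Proof. exact: big_ord_recr. Qed.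

Lemma lac_sum0 e : lac_sum e 0 = 0.
Proof. exact: big_ord0. Qed.

Lemma polylXn_lead n :
  deg_le (polyl 'X ^- n : laurent K) (- n%:Z) /\
  (polyl 'X ^- n : laurent K) (- n%:Z) != 0.
Proof.
have dX : deg_le (polyl 'X ^+ n : laurent K) n.
  rewrite -rmorphXn; apply: deg_leW (deg_le_polyl (p := _)).
  by rewrite size_polyXn.
have lX : (polyl 'X ^+ n : laurent K) n = 1.
  by rewrite -rmorphXn /= coefXn eqxx.
have dV : deg_le (polyl 'X ^- n : laurent K) (- n%:Z).
  by apply: deg_leV => //; rewrite lX oner_neq0.
split=> //; have := deg_leM_lead dX dV; rewrite lX mul1r => <-.
rewrite divff ?subrr ?coefl1 ?oner_neq0 //.
by rewrite expf_neq0 // polyl_eq0 polyX_eq0.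
Qed.

Section Increasing.
Variable e : nat -> nat.
Hypothesis e_incr : {homo e : j k / (j < k)%N}.

Lemma leq_id_incr k : (k <= e k)%N.
Proof. by elim: k => // k IHk; apply: leq_ltn_trans IHk (e_incr _). Qed.

Lemma deg_lac_sumB k m : (k <= m)%N ->
  deg_le (lac_sum e m - lac_sum e k) (- (e k)%:Z).
Proof.
move=> /subnK <-; elim: (m - k)%N => [|n IHn]; first by rewrite add0n subrr.
rewrite addSn lac_sumS addrAC; apply: deg_leD => //.
apply: deg_leW (proj1 (polylXn_lead _)).
by rewrite lerN2 lez_nat (ltnW_homo e_incr) // leq_addl.
Qed.

Lemma deg_lac_sum k : deg_le (lac_sum e k) (- (e 0)%:Z).
Proof. by rewrite -[lac_sum e k]subr0 -(lac_sum0 e); apply: deg_lac_sumB. Qed.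

Lemma lacunary_exists : exists f, is_lacunary e f.
Proof.
have stab (n : int) k : (`|n| < k)%N ->
    lac_sum e `|n|%N.+1 n = lac_sum e k n.
  move=> nk; apply/esym/eqP; rewrite -subr_eq0 -coeflB; apply/eqP.
  by apply: deg_lac_sumB => //; have := leq_id_incr `|n|%N.+1; lia.
have f_bounded : exists N : int, forall n, N < n -> lac_sum e `|n|%N.+1 n = 0.
  by exists (- (e 0)%:Z) => n; apply: deg_lac_sum.
(* As k <= e k, the terms past index |n| do not contribute to degree n. *)
exists (Laurent f_bounded) => k n kn; rewrite coeflB /=.
have [nk|kn'] := ltnP `|n|%N k; first by rewrite (stab _ _ nk) subrr.
rewrite -coeflB; apply: deg_lac_sumB kn; lia.
Qed.

Lemma lacunary_unique f g : is_lacunary e f -> is_lacunary e g -> f = g.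
Proof.
move=> fe ge; apply/laurentP => n; apply/eqP; rewrite -subr_eq0 -coeflB.
pose k := `|n|%N.+1; have ke := leq_id_incr k.
have -> : f - g = (f - lac_sum e k) - (g - lac_sum e k) by ring.
by rewrite (deg_leD (fe k) (deg_leN (ge k))) //; lia.
Qed.

Lemma lac_sum_inj : injective (lac_sum e).
Proof.
have lt_neq j k : (j < k)%N -> lac_sum e j <> lac_sum e k.
  move=> jk jkE; have [_ /eqP[]] := polylXn_lead (e j).
  have := deg_lac_sumB jk; rewrite -jkE lac_sumS opprD addNKr => d.
  apply/oppr_inj; rewrite oppr0 -coeflN; apply: d.
  by have := e_incr (ltnSn j); lia.
move=> j k jkE; case: (ltngtP j k) => // /lt_neq; first by rewrite jkE.
by rewrite jkE.
Qed.

Lemma lac_sum_fraction k :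
  exists p, lac_sum e k.+1 = polyl p / polyl ('X^(e k)).
Proof.
have X0 n : (polyl 'X : laurent K) ^+ n != 0.
  by rewrite expf_neq0 // polyl_eq0 polyX_eq0.
exists (\sum_(j < k.+1) 'X^(e k - e j)).
rewrite rmorph_sum rmorphXn /= mulr_suml; apply: eq_bigr => j _.
have jk : (e j <= e k)%N by rewrite (ltnW_homo e_incr) // -ltnS.
rewrite rmorphXn /= -[in X in _ / X](subnK jk) exprD.
by field; rewrite !X0.
Qed.

(** The partial sum up to [e k] has denominator [z ^+ e k], and its difference with
    [f] has degree at most [- e k.+1]. When [e k.+1] exceeds [d * e k] by more than any
    constant, Liouville's inequality forces the partial sums to be roots of [Q] for
    all large [k], and these are infinitely many. *)
Theorem lacunary_degree_gt d f (Q : {poly {fraction {poly K}}}) :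
  (forall C, exists k0, forall k, (k0 <= k)%N -> (d * e k + C < e k.+1)%N) ->
  is_lacunary e f -> (size Q <= d.+1)%N -> root (map_poly (@ratl K) Q) f -> Q = 0.
Proof.
move=> gap fe Qd Qf; apply/eqP/contraT => Q0.
have fN : deg_le f (- (e 0)%:Z) by rewrite -[f]subr0 -(lac_sum0 e); apply: fe.
have [C QC] := liouville fN Qf Qd; have [k0 gap0] := gap `|C|%N.
have Qroot k : (k0 <= k)%N -> root (map_poly (@ratl K) Q) (lac_sum e k.+1).
  move=> /gap0 gapk; have [p pE] := lac_sum_fraction k; rewrite pE.
  apply: (QC _ _ (- (e k.+1)%:Z)); rewrite -?pE ?size_polyXn //.
  - by rewrite monic_neq0 ?monicXn.
  - exact: deg_lac_sum.
  - by rewrite -opprB; apply/deg_leN/fe.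
  - by rewrite mulnC; lia.
have Ql0 : map_poly (@ratl K) Q != 0 by rewrite map_poly_eq0.
pose rs := [seq lac_sum e k.+1 | k <- iota k0 (size Q)].
have : (size rs < size (map_poly (@ratl K) Q))%N.
  apply: max_poly_roots => //; last first.
    by rewrite map_inj_uniq ?iota_uniq // => j k /lac_sum_inj/succn_inj.
  by apply/allP => x /mapP[k]; rewrite mem_iota => /andP[k0k _] ->; exact: Qroot.
by rewrite size_map size_iota size_map_poly ltnn.
Qed.

End Increasing.
End Lacunary.

(** * Palindromic prefixes of the period-doubling sequence *)

Section PeriodDoublingPrefixes.
Variables (T : eqType) (a b : T).
Hypothesis ab : a != b.
Local Notation pd := (period_doubling a b).

Lemma pd_even n : pd n.*2 = a.
Proof.
by have := period_doubling_fixed a b n; rewrite /pd_subst; case: ifP => _ [].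
Qed.

Lemma pd_odd n : pd n.*2.+1 = if pd n == a then b else a.
Proof.
by have := period_doubling_fixed a b n; rewrite /pd_subst; case: ifP => _ [].
Qed.

(** The letter at n depends on the parity of the 2-adic valuation of n + 1 only,
    and adding 2 ^ n does not change that of i + 1 < 2 ^ n. *)
Lemma pd_shift n i : (i < (2 ^ n).-1)%N -> pd (2 ^ n + i) = pd i.
Proof.
elim: n i => // n IHn i; rewrite expnS mul2n; rewrite -(odd_double_half i).
case: (odd i) => i_lt; last by rewrite !add0n -doubleD !pd_even.
by rewrite !add1n addnS -doubleD !pd_odd IHn //; lia.
Qed.

Lemma pd_center n : pd (2 ^ n).-1 = if odd n then b else a.
Proof.
elim: n => // n IHn; have -> : (2 ^ n.+1).-1 = (2 ^ n).-1.*2.+1.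
  by have := expn_gt0 2 n; rewrite expnS; lia.
rewrite pd_odd IHn /=; case: (odd n); rewrite /= ?eqxx //.
by rewrite eq_sym (negPf ab).
Qed.

Lemma pd_prefixS n : mkseq pd (2 ^ n.+1).-1 =
  mkseq pd (2 ^ n).-1 ++ (if odd n then b else a) :: mkseq pd (2 ^ n).-1.
Proof.
have n0 := expn_gt0 2 n.
have -> : (2 ^ n.+1).-1 = ((2 ^ n).-1 + (2 ^ n).-1.+1)%N by rewrite expnS; lia.
rewrite /mkseq iotaD map_cat /= add0n pd_center; congr (_ ++ _ :: _).
rewrite prednK // -{1}[(2 ^ n)%N]addn0 iotaDl -map_comp.
by apply/eq_in_map => i; rewrite mem_iota => /= /pd_shift.
Qed.

Lemma pd_prefix_palindrome n : rev (mkseq pd (2 ^ n).-1) = mkseq pd (2 ^ n).-1.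
Proof.
by elim: n => // n IHn; rewrite pd_prefixS rev_cat rev_cons IHn cat_rcons.
Qed.

End PeriodDoublingPrefixes.

(** * Continuants and the folding lemma *)

Section Continuants.
Variable R : comNzRingType.
Implicit Types (x : R) (s : seq R).

Definition letter_mx x : 'M[R]_2 :=
  \matrix_(i, j) if (i == 0) && (j == 0) then x else (i != j)%:R.

(** This matrix maps the column (1, t) to a multiple of (1, f), where f is the
    continued fraction of s followed by the tail t. At t = 0, its first column holds
    the denominator (row 0) and the numerator (row 1) for s itself. *)
Definition cf_mx s : 'M[R]_2 := \big[*%R/1]_(x <- s) letter_mx x.

Lemma mx2E (A B : 'M[R]_2) i j : (A * B) i j = A i 0 * B 0 j + A i 1 * B 1 j.
Proof.
rewrite mxE !big_ord_recl big_ord0 addr0.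
by congr (_ + A i _ * B _ j); apply: val_inj.
Qed.

Lemma cf_mx_cons x s : cf_mx (x :: s) = letter_mx x * cf_mx s.
Proof. exact: big_cons. Qed.

Lemma cf_mx_cat s t : cf_mx (s ++ t) = cf_mx s * cf_mx t.
Proof. exact: big_cat. Qed.

Lemma cf_mx_cons0 x s i : cf_mx (x :: s) 0 i = x * cf_mx s 0 i + cf_mx s 1 i.
Proof. by rewrite cf_mx_cons mx2E !mxE /= mul1r. Qed.

Lemma cf_mx_cons1 x s i : cf_mx (x :: s) 1 i = cf_mx s 0 i.
Proof. by rewrite cf_mx_cons mx2E !mxE /= mul1r mul0r addr0. Qed.

Lemma cf_mx_rev s : cf_mx (rev s) = (cf_mx s)^T.
Proof.
elim: s => [|x s IHs]; first by rewrite /cf_mx !big_nil trmx1.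
rewrite rev_cons -cats1 cf_mx_cat IHs (cf_mx_cons x s : _ = _ *m _) trmx_mul.
rewrite {2}/cf_mx big_seq1; congr (_ *m _).
by apply/matrixP => i j; rewrite !mxE andbC [i == j]eq_sym.
Qed.

Lemma det_cf_mx s :
  cf_mx s 0 0 * cf_mx s 1 1 - cf_mx s 0 1 * cf_mx s 1 0 = (-1) ^+ size s.
Proof.
elim: s => [|x s IHs].
  by rewrite /cf_mx big_nil !mxE /= mulr1 mul0r subr0.
by rewrite !cf_mx_cons0 !cf_mx_cons1 exprS -IHs; ring.
Qed.

(** As the letter matrices are symmetric, reversing a word transposes its matrix:
    that of the folded word is A M A^T, where A is the matrix of s and M that of
    x. In characteristic 2, the cross terms of the quadratic form that gives its
    first entry cancel, and the determinant of A is 1. *)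
Lemma folding_mx x s : 2 = 0 :> R ->
  cf_mx (s ++ x :: rev s) 0 0 = x * cf_mx s 0 0 ^+ 2 /\
  cf_mx (s ++ x :: rev s) 1 0 = x * cf_mx s 0 0 * cf_mx s 1 0 + 1.
Proof.
move=> two0; have := det_cf_mx s.
have -> : (-1) ^+ size s = 1 :> R.
  have -> : -1 = 1 :> R by apply/eqP; rewrite eq_sym -addr_eq0 -mulr2n two0.
  by rewrite expr1n.
rewrite cf_mx_cat !mx2E cf_mx_cons0 cf_mx_cons1 cf_mx_rev ![_^T _ _]mxE.
by move/(canRL (subrK _)) => d; split; ring: two0 d.
Qed.

End Continuants.

Section Convergents.
Variable K : fieldType.
Implicit Types (x : {poly K}) (s : seq {poly K}).

(** Partial quotients that are not constant make the denominators grow, so that no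
    division by zero occurs in the continued fraction. *)
Lemma cf_mx_denom_gt s : (forall x, x \in s -> (1 < size x)%N) ->
  (size (cf_mx s 1 0)%R < size (cf_mx s 0 0)%R)%N.
Proof.
elim: s => [|x s IHs] xs.
  by rewrite /cf_mx big_nil !mxE /= size_poly0 size_poly1.
have {}IHs := IHs (fun y ys => xs y (mem_behead (s := x :: s) ys)).
have x1 := xs x (mem_head _ _); rewrite cf_mx_cons0 cf_mx_cons1.
have Q0 : cf_mx s 0 0 != 0 by rewrite -size_poly_gt0; lia.
have xn0 : x != 0 by rewrite -size_poly_gt0; lia.
have sz : (size (cf_mx s 0 0)%R < size (x * cf_mx s 0 0)%R)%N.
  rewrite size_mul //; case: (size x) x1 => [|[|m]] // _.
  by rewrite !addSn ltnS leq_addl.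
by rewrite size_polyDl // (ltn_trans IHs).
Qed.

Lemma cf_mx_denom_neq0 s : (forall x, x \in s -> (1 < size x)%N) ->
  polyl (cf_mx s 0 0) != 0.
Proof.
move=> /cf_mx_denom_gt lt.
by rewrite polyl_eq0 -size_poly_gt0 (leq_ltn_trans (leq0n _) lt).
Qed.

Lemma foldr_cf_mx s : (forall x, x \in s -> (1 < size x)%N) ->
  foldr (fun x f => (polyl x + f)^-1) 0 s =
  polyl (cf_mx s 1 0) / polyl (cf_mx s 0 0).
Proof.
elim: s => [|x s IHs] xs; first by rewrite /cf_mx big_nil mxE /= rmorph0 mul0r.
have xs' y (ys : y \in s) := xs y (mem_behead (s := x :: s) ys).
rewrite /= (IHs xs') cf_mx_cons0 cf_mx_cons1 rmorphD rmorphM /=.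
rewrite -[in RHS]invf_div; congr (_^-1).
by rewrite mulrDl mulfK // cf_mx_denom_neq0.
Qed.

(** With S / Q the value for s, the entries found in [folding_mx] have the quotient
    (x Q S + 1) / (x Q^2) = S / Q + 1 / (x Q^2). *)
Lemma folding x s : 2 = 0 :> K -> (1 < size x)%N ->
  (forall x, x \in s -> (1 < size x)%N) ->
  foldr (fun x f => (polyl x + f)^-1) 0 (s ++ x :: rev s) =
  foldr (fun x f => (polyl x + f)^-1) 0 s + (polyl (x * cf_mx s 0 0 ^+ 2))^-1.
Proof.
move=> two0 x1 xs; have two0' : 2 = 0 :> {poly K}.
  by rewrite -[2]/(2%:R) -polyC_natr two0.
have [Q S] := folding_mx x s two0'.
rewrite !foldr_cf_mx //; last first.
  move=> y; rewrite mem_cat inE mem_rev => /or3P[|/eqP ->|] //; exact: xs.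
rewrite Q S rmorphD rmorph1 !(rmorphXn, rmorphM) /=.
have ? := cf_mx_denom_neq0 xs.
have ? : polyl x != 0 by rewrite polyl_eq0 -size_poly_gt0; lia.
by field; apply/andP.
Qed.

End Convergents.

(** * Algebra in characteristic 2 *)

Lemma horner_cubic (R : nzRingType) (p : {poly R}) x : (size p <= 4)%N ->
  p.[x] = p`_0 + p`_1 * x + p`_2 * x ^+ 2 + p`_3 * x ^+ 3.
Proof.
move=> p4; rewrite (horner_coef_wide _ p4) !big_ord_recr big_ord0 /=.
by rewrite add0r expr0 mulr1 expr1.
Qed.

Lemma horner_map_quartic (F E : fieldType) (f : {rmorphism F -> E})
    (c2 c1 c0 : F) (y : E) :
  (map_poly f ('X^4 + c2 *: 'X^2 + c1 *: 'X + c0%:P)).[y] =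
  y ^+ 4 + f c2 * y ^+ 2 + f c1 * y + f c0.
Proof.
by rewrite !rmorphD /= !map_polyZ !map_polyXn map_polyX map_polyC /= !hornerE.
Qed.

Section CharTwoAlgebra.
Variable F : fieldType.
Hypothesis charF2 : 2%N \in [pchar F].

Let two0 : 2 = 0 :> F. Proof. exact: pcharf0 charF2. Qed.

Lemma exprD4_pchar2 (x y : F) : (x + y) ^+ 4 = x ^+ 4 + y ^+ 4.
Proof. by rewrite exprDn_pchar // (pnatX _ 2 2) pnatE ?charF2. Qed.

(** The system that remains for the coefficients c and d of y and y^2, once the
    coefficient of y^3 is known to vanish. *)
Lemma two_coords_eq0 (z c d : F) : z != 0 -> 1 + z != 0 ->
  z ^+ 2 * d + c = 0 -> d + z^-1 * c = 0 -> d = 0.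
Proof.
move=> z0 z1 e1 e2; have : z * (1 + z) * d = 0.
  have -> : z * (1 + z) * d =
    (z ^+ 2 * d + c) + z * (d + z^-1 * c) - 2 * c by field.
  by rewrite e1 e2 two0 mulr0 mul0r addr0 subr0.
by move/eqP; rewrite !mulf_eq0 (negPf z0) (negPf z1) => /eqP.
Qed.

Section Quartic.
Variables z u : F.
Hypotheses (z0 : z != 0) (uE : u ^+ 4 = z ^+ 4 * u + z ^+ 2).
Local Notation y := (u + u ^+ 2 / z).

Lemma sqr_in_basis : y ^+ 2 = u ^+ 2 + z ^+ 2 * u + 1.
Proof.
have -> : y ^+ 2 = u ^+ 2 + u ^+ 4 / z ^+ 2 + 2 * (u ^+ 3 / z) by field.
by rewrite two0 uE; field.
Qed.

Lemma cube_in_basis : y ^+ 3 =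
  (1 + z) * u ^+ 3 + (z ^+ 2 + z^-1) * u ^+ 2 + (1 + z ^+ 3) * u + z.
Proof.
rewrite exprS sqr_in_basis.
have -> : y * (u ^+ 2 + z ^+ 2 * u + 1) = u ^+ 4 / z +
  ((1 + z) * u ^+ 3 + (z ^+ 2 + z^-1) * u ^+ 2 + u) by field.
by rewrite uE; field.
Qed.

Lemma quartic_root :
  y ^+ 4 + z ^+ 3 * y ^+ 2 + (z ^+ 5 + z ^+ 4) * y + (z ^+ 3 + z ^+ 2 + 1) = 0.
Proof.
have -> : y ^+ 4 = u ^+ 4 + z ^+ 4 * u ^+ 2 + 1.
  by rewrite (exprM _ 2 2) sqr_in_basis; ring: two0.
rewrite sqr_in_basis uE.
have -> : (z ^+ 5 + z ^+ 4) * y =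
  (z ^+ 5 + z ^+ 4) * u + (z ^+ 4 + z ^+ 3) * u ^+ 2 by field.
by ring: two0.
Qed.

End Quartic.
End CharTwoAlgebra.

(** * The continued fraction of the period-doubling sequence *)

Section PeriodDoublingCharTwo.
Variable K : fieldType.
Hypothesis charK2 : 2%N \in [pchar K].
Local Notation L := (laurent K).
Local Notation z := (polyl 'X : L).
Local Notation a := ('X^2 : {poly K}).
Local Notation b := ('X : {poly K}).
Local Notation pd := (period_doubling a b).
Local Notation cfrac s := (foldr (fun x f => (polyl x + f)^-1) (0 : L) s).

(** The degrees 2, 12, 52, ... of the denominators of odd index. *)
Definition sparse_exp (k : nat) : nat := iter k (fun e => 4 * e + 4) 2.

Lemma sparse_expS k : sparse_exp k.+1 = (4 * sparse_exp k + 4)%N.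
Proof. by []. Qed.

Lemma sparse_exp_incr : {homo sparse_exp : j k / (j < k)%N}.
Proof. by apply: homo_ltn ltn_trans _ => k; rewrite sparse_expS; lia. Qed.

Lemma pchar_poly : 2%N \in [pchar {poly K}].
Proof. by rewrite pchar_lalg. Qed.

Lemma pchar_laurent : 2%N \in [pchar L].
Proof. exact: rmorph_pchar (@polyl K) _ pchar_poly. Qed.

Lemma two_laurent : 2 = 0 :> L. Proof. exact: pcharf0 pchar_laurent. Qed.

Lemma subl_char2 (f g : L) : f - g = f + g.
Proof. by rewrite (GRing.subr_pchar2 pchar_laurent). Qed.

Lemma z_neq0 : z != 0. Proof. by rewrite polyl_eq0 polyX_eq0. Qed.

Lemma pd_letters : a != b.
Proof.
by apply/eqP => /(congr1 (size \o polyseq)) /=; rewrite size_polyXn size_polyX.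
Qed.

Lemma size_pd n : (1 < size (pd n))%N.
Proof.
rewrite -(odd_double_half n); case: (odd n); last first.
  by rewrite pd_even size_polyXn.
by rewrite pd_odd; case: ifP; rewrite ?size_polyXn ?size_polyX.
Qed.

Lemma size_pd_prefix m x : x \in mkseq pd m -> (1 < size x)%N.
Proof. by move=> /mapP[n _ ->]; exact: size_pd. Qed.

Lemma cfrac_pd_prefixS n (x := if odd n then b else a)
    (Q := cf_mx (mkseq pd (2 ^ n).-1) 0 0) :
  cf_mx (mkseq pd (2 ^ n.+1).-1) 0 0 = x * Q ^+ 2 /\
  cfrac (mkseq pd (2 ^ n.+1).-1) =
    cfrac (mkseq pd (2 ^ n).-1) + (polyl (x * Q ^+ 2))^-1.
Proof.
have two0 : 2 = 0 :> {poly K} by exact: pcharf0 pchar_poly.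
rewrite pd_prefixS ?pd_letters // -/x -{2 4}pd_prefix_palindrome ?pd_letters //.
have [-> _] := folding_mx x (mkseq pd (2 ^ n).-1) two0.
rewrite folding //; [exact: pcharf0 charK2| |exact: size_pd_prefix].
by rewrite /x; case: (odd n); rewrite ?size_polyXn ?size_polyX.
Qed.

(** The prefixes are taken two by two: going from k to k + 1 adds to the continued
    fraction the terms [z ^- e] and [z ^- (2 * e + 1)], where [e] is
    [sparse_exp k], and these are the increments of u and of u^2 / z. The first
    equation expresses the denominator through [e] without division; for k = 0
    it holds as the empty word has denominator 1. *)
Lemma cfrac_pd_prefix k (s := mkseq pd (2 ^ k.*2).-1)
    (u := lac_sum K sparse_exp k) :
  cf_mx s 0 0 ^+ 2 * 'X^2 = 'X^(sparse_exp k) /\ cfrac s = u + u ^+ 2 / z.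
Proof.
rewrite /s /u {s u}; elim: k => [|k [IHQ IHs]].
  by rewrite lac_sum0 /cf_mx big_nil mxE expr1n mul1r /= expr0n mul0r addr0.
have [Q1 s1] := cfrac_pd_prefixS k.*2; have [Q2 s2] := cfrac_pd_prefixS k.*2.+1.
rewrite sparse_expS doubleS Q2 s2 Q1 s1 /= odd_double /= IHs lac_sumS.
rewrite ['X^2 * _]mulrC IHQ; split.
  by rewrite exprMn -!exprM -!exprD; congr ('X^_); lia.
rewrite rmorphM !rmorphXn /= invfM -!exprVn.
by ring: two_laurent.
Qed.

Lemma CF_pd_sparse (u : L) : is_lacunary sparse_exp u ->
  CF pd = u + u ^+ 2 / z.
Proof.
move=> uP; apply/laurentP => n.
have /laurent_cvgP/(_ n)[N _ yN] := CF_cvg size_pd.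
pose k := (N + `|n|).+1; have ke := leq_id_incr sparse_exp_incr k.
have k2 := ltn_expl k.*2 (ltnSn 1).
have [Nk k1] : (N <= (2 ^ k.*2).-2)%N /\ (0 < (2 ^ k.*2).-1)%N.
  by rewrite /k in k2 *; lia.
(* The convergent of index (2 ^ k.*2).-2 involves the first (2 ^ k.*2).-1 letters. *)
have -> : CF pd n = ratl (CFn pd (2 ^ k.*2).-2) n := yN _ Nk n (lexx n).
rewrite ratl_CFn prednK //.
have [_ ->] := cfrac_pd_prefix k; apply/esym/eqP; rewrite -subr_eq0 -coeflB.
set v := lac_sum _ _ _.
have -> : u + u ^+ 2 / z - (v + v ^+ 2 / z) = (u - v) + (u - v) ^+ 2 / z.
  by rewrite !subl_char2; ring: two_laurent.
have uv : deg_le (u - v) (- (sparse_exp k)%:Z) := uP k.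
have zd : deg_le (z^-1) (-1).
  by have [] := polylXn_lead K 1.
rewrite (deg_leD uv) //; last lia.
by apply: deg_leW (deg_leM (deg_leM uv uv) zd); lia.
Qed.

(** The map v |-> z^-2 + z^-4 v^4 sends each partial sum of the series to the next
    one, hence fixes its sum. *)
Lemma sparse_quartic (u : L) : is_lacunary sparse_exp u ->
  u ^+ 4 = z ^+ 4 * u + z ^+ 2.
Proof.
move=> uP; suff uE : z ^- 2 + u ^+ 4 * z ^- 4 = u.
  have e : z ^+ 4 * (z ^- 2 + u ^+ 4 * z ^- 4) = z ^+ 2 + u ^+ 4.
    by field; rewrite z_neq0.
  by rewrite -{2}uE e; ring: two_laurent.
apply: (lacunary_unique sparse_exp_incr _ uP) => -[|k].
  rewrite lac_sum0 subr0.
  have [u2 _] := polylXn_lead K 2; have [u4 _] := polylXn_lead K 4.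
  have ud : deg_le u (- 2%:Z).
    by rewrite -[u]subr0 -(lac_sum0 K sparse_exp); apply: uP.
  apply: deg_leD u2 _; rewrite (_ : u ^+ 4 = (u * u) * (u * u)); last by ring.
  apply: deg_leW (deg_leM (deg_leM (deg_leM ud ud) (deg_leM ud ud)) u4).
  by rewrite /sparse_exp /=; lia.
have sumE : lac_sum K sparse_exp k.+1 =
    z ^- 2 + lac_sum K sparse_exp k ^+ 4 * z ^- 4.
  elim: k => [|k IHk].
    by rewrite lac_sumS !lac_sum0 add0r expr0n mul0r addr0.
  rewrite lac_sumS {1}IHk lac_sumS -!exprVn sparse_expS mulnC exprD exprM.
  by rewrite (exprD4_pchar2 pchar_laurent); ring.
have -> : z ^- 2 + u ^+ 4 * z ^- 4 - lac_sum K sparse_exp k.+1 =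
    (u - lac_sum K sparse_exp k) ^+ 4 * z ^- 4.
  by rewrite sumE !subl_char2 (exprD4_pchar2 pchar_laurent); ring: two_laurent.
have [z4 _] := polylXn_lead K 4.
have uk := uP k; set v := u - _ in uk *.
rewrite (_ : v ^+ 4 = (v * v) * (v * v)); last by ring.
apply: deg_leW (deg_leM (deg_leM (deg_leM uk uk) (deg_leM uk uk)) z4).
by rewrite sparse_expS; lia.
Qed.

Local Notation zf := ('X%:F : {fraction {poly K}}).

Lemma sparse_degree_gt3 (u : L) (Q : {poly {fraction {poly K}}}) :
  is_lacunary sparse_exp u -> (size Q <= 4)%N ->
  root (map_poly (@ratl K) Q) u -> Q = 0.
Proof.
apply: (lacunary_degree_gt sparse_exp_incr (d := 3)) => C.
by exists C => k; have := leq_id_incr sparse_exp_incr k; rewrite sparse_expS; lia.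
Qed.

(** On the powers of u, the coordinates of 1, y, y^2 and y^3 are those of
    [sqr_in_basis] and [cube_in_basis], hence Q(y) = R(u) for an R that also has
    degree at most 3. So R = 0, and then the coefficients of Q vanish from
    the top. *)
Lemma CF_pd_degree_gt3 (u : L) (Q : {poly {fraction {poly K}}}) :
  is_lacunary sparse_exp u -> (size Q <= 4)%N ->
  root (map_poly (@ratl K) Q) (u + u ^+ 2 / z) -> Q = 0.
Proof.
move=> uP Qsz Qy; have uE := sparse_quartic uP.
have zf0 : zf != 0 by rewrite tofrac_eq0 polyX_eq0.
have zf1 : 1 + zf != 0.
  by rewrite -tofrac1 -tofracD tofrac_eq0 addrC -polyC1 -size_poly_eq0 size_XaddC.
pose R := Poly [:: zf * Q`_3 + Q`_2 + Q`_0;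
  (1 + zf ^+ 3) * Q`_3 + zf ^+ 2 * Q`_2 + Q`_1;
  (zf ^+ 2 + zf^-1) * Q`_3 + Q`_2 + zf^-1 * Q`_1; (1 + zf) * Q`_3].
have R0 : R = 0.
  apply: (sparse_degree_gt3 uP); first exact: size_Poly.
  apply/eqP; move/eqP: Qy.
  rewrite !horner_cubic ?size_map_poly ?size_Poly // !coef_map !coef_Poly /=.
  rewrite !(rmorphD, rmorphM, rmorphXn, rmorph1, fmorphV) /= ratl_tofrac.
  rewrite (sqr_in_basis pchar_laurent z_neq0 uE).
  rewrite (cube_in_basis pchar_laurent z_neq0 uE).
  by move=> <-; ring.
have coefR i := congr1 (fun p : {poly _} => p`_i) R0.
have Q3 : Q`_3 = 0.
  have /eqP := coefR 3; rewrite coef_Poly coef0 /= mulf_eq0 (negPf zf1).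
  by move/eqP.
have Q2 : Q`_2 = 0.
  have := coefR 1%N; have := coefR 2; rewrite !coef_Poly !coef0 /=.
  rewrite Q3 !mulr0 !add0r => e2 e1.
  have charF : 2%N \in [pchar {fraction {poly K}}].
    exact: rmorph_pchar (@FracField.tofrac _) _ pchar_poly.
  exact (two_coords_eq0 charF zf0 zf1 e1 e2).
have Q1 : Q`_1 = 0.
  by have := coefR 1%N; rewrite coef_Poly coef0 /= Q3 Q2 !mulr0 !add0r.
have Q0 : Q`_0 = 0.
  by have := coefR 0; rewrite coef_Poly coef0 /= Q3 Q2 mulr0 !add0r.
apply/polyP => i; rewrite coef0; case: i => [|[|[|[|i]]]] //.
by rewrite nth_default // (leq_trans Qsz).
Qed.

Local Notation quartic := ('X^4 + zf ^+ 3 *: 'X^2 + (zf ^+ 5 + zf ^+ 4) *: 'X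
  + (zf ^+ 3 + zf ^+ 2 + 1)%:P).

Lemma quartic_size_monic : size quartic = 5 /\ quartic \is monic.
Proof.
set r := zf ^+ 3 *: 'X^2 + ((zf ^+ 5 + zf ^+ 4) *: 'X + (zf ^+ 3 + zf ^+ 2 + 1)%:P).
have -> : quartic = 'X^4 + r by rewrite /r !addrA.
have r4 : (size r < size ('X^4 : {poly {fraction {poly K}}}))%N.
  rewrite size_polyXn ltnS (leq_trans (size_polyD _ _)) // geq_max.
  rewrite (leq_trans (size_scale_leq _ _)) ?size_polyXn //=.
  rewrite (leq_trans (size_polyD _ _)) // geq_max.
  rewrite (leq_trans (size_scale_leq _ _)) ?size_polyX //=.
  by rewrite (leq_trans (size_polyC_leq1 _)).
by rewrite size_polyDl // size_polyXn monicE lead_coefDl // lead_coefXn.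
Qed.

Theorem CF_pd_min_poly : algebraicOver (@ratl K) (CF pd) /\
  is_min_poly (@ratl K) (CF pd) quartic.
Proof.
have [u uP] := lacunary_exists K sparse_exp_incr.
have [qsz qmonic] := quartic_size_monic.
have qroot : root (map_poly (@ratl K) quartic) (CF pd).
  rewrite (CF_pd_sparse uP); apply/rootP.
  rewrite horner_map_quartic !(rmorphD, rmorphXn, rmorph1) /= ratl_tofrac.
  exact (quartic_root pchar_laurent z_neq0 (sparse_quartic uP)).
split; first by exists quartic; rewrite ?monic_neq0.
split=> // Q Q0; rewrite (CF_pd_sparse uP) => Qy; rewrite qsz ltnNge.
by apply: contra Q0 => Q4; apply/eqP/(CF_pd_degree_gt3 uP).
Qed.

End PeriodDoublingCharTwo.

Theorem theorem4p1 :
  let p : nat -> {poly 'F_2} := period_doubling ('X^2) 'X in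
  let z : {fraction {poly 'F_2}} := 'X%:F in
  algebraicOver (@ratl 'F_2) (CF p) /\
  is_min_poly (@ratl 'F_2) (CF p)
    ('X^4 + z ^+ 3 *: 'X^2 + (z ^+ 5 + z ^+ 4) *: 'X + (z ^+ 3 + z ^+ 2 + 1)%:P).
Proof. exact: CF_pd_min_poly (pchar_Fp _). Qed.
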